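(* Let $(X,\Sigma,\mu)$ be a measure space. Then $L_\infty(X,\Sigma,\mu)$ does not have the weak Banach--Saks property if and only if there exists a sequence $(A_n)_{n\in\mathbb{N}}$ of pairwise disjoint measurable sets of positive measure.
   Context: A Banach space $Y$ has the weak Banach--Saks property (is weakly Banach--Saks) if every weakly convergent sequence $y_n \to y$ in $Y$ contains a subsequence $(y_{n_k})$ such that $\left\| \frac{1}{N}\sum_{k=1}^N y_{n_k} - y \right\|_Y \to 0$ as $N \to \infty$. $L_\infty(X,\Sigma,\mu)$ is the Banach space of ($\mu$-a.e. equivalence classes of) essentially bounded measurable real-valued functions on $X$ with the essential supremum norm. *)

(* Defs.v *)
From HB Require Import structures.
From mathcomp Require Import all_boot all_order all_algebra.
From mathcomp Require Import all_classical all_reals all_analysis.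
From mathcomp Require Import measurable_realfun ess_sup_inf.

Set Implicit Arguments.
Unset Strict Implicit.
Unset Printing Implicit Defensive.

Import Order.TTheory GRing.Theory Num.Theory.
Import numFieldNormedType.Exports.

Local Open Scope classical_set_scope.
Local Open Scope ring_scope.

Definition weakly_cvg (R : realType) (V : normedModType R)
    (u : nat -> V) (l : V) : Prop :=
  forall phi : {linear V -> R^o}, continuous phi ->
    phi (u n) @[n --> \oo] --> phi l.

Definition weak_banach_saks (R : realType) (Y : completeNormedModType R)
    : Prop :=
  forall (y : nat -> Y) (l : Y), weakly_cvg y l ->
    exists2 k : nat -> nat, {homo k : i j / (i < j)%N} &
      `| N%:R^-1 *: (\sum_(i < N) y (k i)) - l | @[N --> \oo] --> (0 : R).

Section Linfty.
Context d (X : measurableType d) (R : realType).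
Variable mu : {measure set X -> \bar R}.

(* The elements are the a.e.-classes of measurable functions with finite
   essential supremum norm; the coercion of a class to a function picks a
   representative, so pointwise facts hold only almost everywhere. The library
   gives this type no vector space or norm; they are built below. *)
Definition Linfty : Type := LspaceType mu (leey (1 : \bar R)).

HB.instance Definition _ := gen_eqMixin Linfty.
HB.instance Definition _ := gen_choiceMixin Linfty.

Local Notation LI := (LfunType mu (leey (1 : \bar R))).

Lemma eq_Lnormy (g h : X -> R) : g = h %[ae mu] ->
  ('N[mu]_+oo [EFin \o g] = 'N[mu]_+oo [EFin \o h])%E.
Proof.
move=> gh; rewrite unlock; case: ifPn => // _.
by apply: eq_ess_sup; apply: filterS gh => x /= ->.
Qed.

Section class.
Variable f : LI.

(* {mfun X >-> R} and {mfun X >-> measurableTypeR R} use the same sigma-algebra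
   on R under different displays, whence the repackaging. *)
Let mf : @measurable_fun _ _ X (measurableTypeR R) setT f.
Proof. exact: (@measurable_funPT _ _ _ _ f). Qed.

Let fmR : {mfun X >-> measurableTypeR R} :=
  HB.pack (f : X -> measurableTypeR R)
    (@isMeasurableFun.Build _ _ X (measurableTypeR R) f mf).

Let c : {mfun_ mu, X >-> measurableTypeR R} :=
  (\pi_({mfun_ mu, X >-> measurableTypeR R}) fmR)%qT.

Let ae_eq_c : c = f %[ae mu].
Proof. by apply/asboolP; have /eqmodP := reprK c. Qed.

Let finite_norm_c : finite_norm mu +oo%E c.
Proof.
by rewrite /finite_norm (eq_Lnormy ae_eq_c); exact: Lfunction_finite.
Qed.

Definition linf_class : Linfty :=
  HB.pack c (isFinLebesgue.Build d X R mu +oo%E (leey (1 : \bar R)) c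
    finite_norm_c).

Lemma ae_eq_linf_class : linf_class = f %[ae mu].
Proof. exact: ae_eq_c. Qed.

End class.

Section repr.
Variable x : Linfty.

Let mx : (x : X -> R) \in @mfun _ _ X R.
Proof.
rewrite inE /=.
exact: (@measurable_funPT _ _ _ _
  (repr (x : {mfun_ mu, X >-> measurableTypeR R}))).
Qed.

Let Lx : (x : X -> R) \in Lfun mu +oo%E.
Proof.
apply/andP; split; first exact: mx.
by rewrite inE /=; case: x => c [[]].
Qed.

Definition linf_fun : LI := Lfun_Sub (leey (1 : \bar R)) Lx.

Lemma linf_funE : linf_fun = x :> (X -> R). Proof. by []. Qed.
End repr.

Lemma linf_eqP (x y : Linfty) : x = y <-> x = y %[ae mu].
Proof.
split=> [->|xy]; first exact: ae_eq_refl.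
case: x y xy => x [[fx]] [y [[fy]]] /= xy.
have exy : x = y.
  rewrite -[x]reprK -[y]reprK; apply/eqmodP; exact/asboolP.
by case: _ / exy fy {xy} => fy; rewrite (Prop_irrelevance fx fy).
Qed.

Definition linf_add (x y : Linfty) : Linfty :=
  linf_class (linf_fun x + linf_fun y).
Definition linf_opp (x : Linfty) : Linfty := linf_class (- linf_fun x).
Definition linf_zero : Linfty := linf_class 0.
Definition linf_scale (a : R) (x : Linfty) : Linfty :=
  linf_class (a *: linf_fun x).

Lemma ae_linf_add (x y : Linfty) : \forall t \ae mu, linf_add x y t = x t + y t.
Proof.
by apply: filterS (ae_eq_linf_class (linf_fun x + linf_fun y)) => t ->.
Qed.

Lemma ae_linf_opp (x : Linfty) : \forall t \ae mu, linf_opp x t = - x t.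
Proof. by apply: filterS (ae_eq_linf_class (- linf_fun x)) => t ->. Qed.

Lemma ae_linf_zero : \forall t \ae mu, linf_zero t = 0.
Proof. by apply: filterS (ae_eq_linf_class 0) => t ->. Qed.

Lemma ae_linf_scale a (x : Linfty) :
  \forall t \ae mu, linf_scale a x t = a * x t.
Proof. by apply: filterS (ae_eq_linf_class (a *: linf_fun x)) => t ->. Qed.

Let addA : associative linf_add.
Proof.
move=> x y z; apply/linf_eqP.
apply: filterS (filterI (ae_linf_add x (linf_add y z))
  (filterI (ae_linf_add y z) (filterI (ae_linf_add (linf_add x y) z)
  (ae_linf_add x y)))) => t [-> [-> [-> ->]]] _.
by rewrite addrA.
Qed.

Let addC : commutative linf_add.
Proof.
move=> x y; apply/linf_eqP.
apply: filterS (filterI (ae_linf_add x y) (ae_linf_add y x)) => t [-> ->] _.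
by rewrite addrC.
Qed.

Let add0 : left_id linf_zero linf_add.
Proof.
move=> x; apply/linf_eqP.
apply: filterS (filterI (ae_linf_add linf_zero x) ae_linf_zero)
  => t [-> ->] _.
by rewrite add0r.
Qed.

Let addN : left_inverse linf_zero linf_opp linf_add.
Proof.
move=> x; apply/linf_eqP.
apply: filterS (filterI (ae_linf_add (linf_opp x) x) (filterI (ae_linf_opp x)
  ae_linf_zero)) => t [-> [-> ->]] _.
by rewrite addNr.
Qed.

HB.instance Definition _ := GRing.isZmodule.Build Linfty addA addC add0 addN.

Let scaleA a b x : linf_scale a (linf_scale b x) = linf_scale (a * b) x.
Proof.
apply/linf_eqP.
apply: filterS (filterI (ae_linf_scale a (linf_scale b x))
  (filterI (ae_linf_scale b x) (ae_linf_scale (a * b) x))) => t [-> [-> ->]] _.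
by rewrite mulrA.
Qed.

Let scale1 : left_id 1 linf_scale.
Proof.
move=> x; apply/linf_eqP; apply: filterS (ae_linf_scale 1 x) => t -> _.
by rewrite mul1r.
Qed.

Let scaleDr : right_distributive linf_scale +%R.
Proof.
move=> a x y; apply/linf_eqP.
apply: filterS (filterI (ae_linf_scale a (linf_add x y))
  (filterI (ae_linf_add x y)
  (filterI (ae_linf_add (linf_scale a x) (linf_scale a y))
  (filterI (ae_linf_scale a x) (ae_linf_scale a y))))) => t [-> [-> [-> [-> ->]]]] _.
by rewrite mulrDr.
Qed.

Let scaleDl x : {morph linf_scale^~ x : a b / a + b}.
Proof.
move=> a b; apply/linf_eqP.
apply: filterS (filterI (ae_linf_scale (a + b) x) (filterI (ae_linf_scale a x)
  (filterI (ae_linf_scale b x)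
  (ae_linf_add (linf_scale a x) (linf_scale b x))))) => t [-> [? [? ->]]] _.
by rewrite mulrDl; congr (_ + _).
Qed.

HB.instance Definition _ := GRing.Zmodule_isLmodule.Build R Linfty
  scaleA scale1 scaleDr scaleDl.

Lemma ae_addE (x y : Linfty) : \forall t \ae mu, (x + y : Linfty) t = x t + y t.
Proof. exact: ae_linf_add. Qed.

Lemma ae_oppE (x : Linfty) : \forall t \ae mu, (- x : Linfty) t = - x t.
Proof. exact: ae_linf_opp. Qed.

Lemma ae_scaleE a (x : Linfty) :
  \forall t \ae mu, (a *: x : Linfty) t = a * x t.
Proof. exact: ae_linf_scale. Qed.

Lemma ae_zeroE : \forall t \ae mu, (0 : Linfty) t = 0.
Proof. exact: ae_linf_zero. Qed.

Definition linf_norm (x : Linfty) : R := fine ('N[mu]_+oo [EFin \o x])%E.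

Lemma Lnormy_le (f : X -> R) (c : R) : 0 <= c ->
  (\forall t \ae mu, `|f t| <= c) -> ('N[mu]_+oo [EFin \o f] <= c%:E)%E.
Proof.
move=> c0 fc; rewrite unlock; case: ifPn => [_|]; last by rewrite lee_fin.
by apply/ess_supP; apply: filterS fc => t /=; rewrite lee_fin.
Qed.

Lemma linf_normE (x : Linfty) : (linf_norm x)%:E = ('N[mu]_+oo [EFin \o x])%E.
Proof. exact: (finite_norm_fine (linf_fun x)). Qed.

Lemma linf_norm_le (x : Linfty) (c : R) : 0 <= c ->
  (\forall t \ae mu, `|x t| <= c) -> linf_norm x <= c.
Proof. by move=> c0 xc; rewrite -lee_fin linf_normE; exact: Lnormy_le. Qed.

Lemma ae_le_linf_norm (x : Linfty) : \forall t \ae mu, `|x t| <= linf_norm x.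
Proof.
have [mu0|mu0] := ltP 0%E (mu setT).
  have /ess_supP : (ess_sup mu (abse \o (EFin \o x)) <= (linf_norm x)%:E)%E.
    by rewrite linf_normE unlock mu0.
  by apply: filterS => t /=; rewrite lee_fin.
exists setT; split => //.
by apply/eqP; rewrite eq_le mu0/=.
Qed.

Lemma linf_norm_ge0 (x : Linfty) : 0 <= linf_norm x.
Proof. by apply: fine_ge0; exact: Lnorm_ge0. Qed.

Let normD (x y : Linfty) : linf_norm (x + y) <= linf_norm x + linf_norm y.
Proof.
apply: linf_norm_le; first by rewrite addr_ge0 ?linf_norm_ge0.
apply: filterS (filterI (ae_addE x y) (filterI (ae_le_linf_norm x)
  (ae_le_linf_norm y))) => t [-> [xt yt]].
by rewrite (le_trans (ler_normD _ _))// lerD.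
Qed.

Let normZ a (x : Linfty) : linf_norm (a *: x) = `|a| * linf_norm x.
Proof.
apply/EFin_inj; rewrite EFinM !linf_normE -(LnormZ (linf_fun x)).
by apply: eq_Lnormy; apply: filterS (ae_scaleE a x).
Qed.

Let norm0_eq0 (x : Linfty) : linf_norm x = 0 -> x = 0.
Proof.
move=> x0; apply/linf_eqP.
apply: filterS (filterI (ae_le_linf_norm x) ae_zeroE) => t [H ->] _; move: H.
by rewrite x0 normr_le0 => /eqP.
Qed.

HB.instance Definition _ := Lmodule_isNormed.Build R Linfty normD normZ
  norm0_eq0.

Lemma linf_normrE (x : Linfty) : `|x| = fine ('N[mu]_+oo [EFin \o x])%E.
Proof. by []. Qed.

Lemma linf_complete (F : set_system Linfty) :
  ProperFilter F -> cauchy F -> cvg F.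
Proof.
move=> FF /cauchyP Fc; pose e n : R := n.+1%:R^-1.
have e0 n : 0 < e n by rewrite /e invr_gt0.
have ecvg : e n @[n --> \oo] --> (0 : R) by exact: cvg_harmonic.
have esmall eps : 0 < eps -> \forall n \near \oo, e n < eps.
  by move=> eps0; exact: cvgr_lt ecvg _ eps0.
have /choice[x Fx] : forall n, exists y, F (ball y (e n)).
  by move=> n; exact: Fc.
have xnm n m : `|x n - x m| <= e n + e m.
  have [y []] := filter_ex (filterI (Fx n) (Fx m)).
  rewrite -!ball_normE /= => yn ym.
  by rewrite (le_trans (ler_distD y _ _))// lerD// ltW// distrC.
have aexnm : \forall t \ae mu, forall n m, `|x n t - x m t| <= e n + e m.
  apply/ae_foralln => n; apply/ae_foralln => m.
  apply: filterS (filterI (ae_addE (x n) (- x m)) (filterI (ae_oppE (x m))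
    (ae_le_linf_norm (x n - x m)))) => t [E1 [E2 H]].
  by rewrite -E2 -E1; exact: le_trans H (xnm n m).
have [N [mN muN0 xN]] := aexnm.
have xNE t : ~ N t -> forall n m, `|x n t - x m t| <= e n + e m.
  by move=> Nt; apply: contrapT => /xN.
pose h n (t : X) : R := x n t * \1_(~` N) t.
have hN t n m : `|h n t - h m t| <= e n + e m.
  rewrite /h indicE; have [/set_mem Nt|/negP Nt] := boolP (t \in ~` N).
    by rewrite !mulr1 xNE.
  by rewrite !mulr0 subrr normr0 addr_ge0// ltW.
have hcvg t : cvg (h n t @[n --> \oo]).
  apply: cauchy_cvg; apply: cauchy_exP => eps eps0.
  near \oo => n; exists (h n t).
  change (\forall m \near \oo, ball (h n t) eps (h m t)); near=> m.
  rewrite -ball_normE /= (le_lt_trans (hN t n m))//.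
  rewrite (splitr eps) ltrD//; [near: n|near: m];
    by exact/(esmall _)/divr_gt0.
pose g t : R := limn (fun n => h n t).
have mg : measurable_fun setT g.
  apply: (@measurable_fun_cvg _ _ _ setT h) => [n|t _]; last exact: hcvg.
  apply: measurable_funM; last by apply: measurable_indic; exact: measurableC.
  exact: (@measurable_funPT _ _ _ _ (linf_fun (x n))).
have hg t n : `|h n t - g t| <= e n.
  have c1 : (`|h n t - h m t| @[m --> \oo] --> `|h n t - g t|).
    by apply: cvg_norm; apply: cvgB; [exact: cvg_cst|exact: hcvg].
  have c2 : (e n + e m @[m --> \oo] --> e n + 0).
    by apply: cvgD; [exact: cvg_cst|exact: ecvg].
  rewrite -[leRHS]addr0; apply: ler_cvg_to c1 c2 _.
  by apply: nearW => m; exact: hN.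
have aeN : \forall t \ae mu, ~ N t.
  by exists N; split => // t /= /contrapT.
have hx t n : ~ N t -> h n t = x n t.
  by move=> Nt; rewrite /h indicE mem_set// mulr1.
have gL : g \in Lfun mu +oo%E.
  apply/andP; split; rewrite inE//=.
  apply: (@le_lt_trans _ _ (e 0%N + `|x 0%N|)%:E); last by rewrite ltry.
  apply: Lnormy_le; first by rewrite addr_ge0// ltW.
  apply: filterS (filterI aeN (ae_le_linf_norm (x 0%N))) => t [Nt xt].
  rewrite -(subrK (h 0%N t) (g t)) (le_trans (ler_normD _ _))// lerD//.
    by rewrite distrC.
  by rewrite hx.
pose l := linf_class (Lfun_Sub (leey (1 : \bar R)) gL).
have xl n : `|x n - l| <= e n.
  apply: linf_norm_le; first exact: ltW.
  apply: filterS (filterI aeN (filterI (ae_addE (x n) (- l))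
    (filterI (ae_oppE l) (ae_eq_linf_class (Lfun_Sub (leey (1 : \bar R)) gL)))))
    => t [Nt [-> [-> /(_ I)]]].
  by rewrite -/l => -> /=; rewrite -hx//; exact: hg.
apply/cvg_ex; exists l; apply/cvg_ballP => eps eps0.
near \oo => n.
apply: filterS (Fx n) => y; rewrite -!ball_normE /= => xy.
rewrite (le_lt_trans (ler_distD (x n) _ _))// (splitr eps) ler_ltD//.
  rewrite distrC (le_trans (xl n))// ltW//.
  by near: n; exact/(esmall _)/divr_gt0.
rewrite (lt_trans xy)//.
by near: n; exact/(esmall _)/divr_gt0.
Unshelve. all: by end_near. Qed.

HB.instance Definition _ := Uniform_isComplete.Build Linfty linf_complete.

End Linfty.

(* Main.v *)
(* If no such sequence exists, weak convergence y_n --> l already forces norm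
   convergence. Otherwise the whole space is "bad": |y_n - l| does not tend to 0
   uniformly a.e. on it. A bad set is not an atom, because on an atom the a.e.
   constant value is a continuous functional; so it splits into two parts of
   positive measure, one of which is bad again. Iterating on the bad part, the
   discarded parts form a disjoint sequence.

   Conversely, disjoint sets A_F of positive measure, indexed by the finite sets
   F of integers with |F| <= min F, yield Schreier's sequence: y_n = 1 on A_F if
   n is in F, and 0 otherwise. For every subsequence, the average of the first 2M
   terms is at least 1/2 on A_F, F the set of the last M of the 2M indices. If
   |phi (y_n)| > e for infinitely many n, one forms averages u_j of the signed
   y_n over successive blocks of these n, each block being much longer than the
   integers in the preceding ones. Once F meets a block, |F| is bounded by an
   element of that block, so F is negligible in all later blocks; hence
   |u_0 + ... + u_(m-1)| <= 3 for all m, while phi (u_j) >= e. *)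
Require Import Defs.
From HB Require Import structures.
From mathcomp Require Import all_boot all_order all_algebra.
From mathcomp Require Import all_classical all_reals all_analysis.
From mathcomp Require Import measurable_realfun ring lra.
Import Order.TTheory GRing.Theory Num.Theory.
Import numFieldNormedType.Exports.
Local Open Scope classical_set_scope.
Local Open Scope ring_scope.

(** * Atoms, bad sets and norm convergence *)

Section linfty_facts.
Context (R : realType) (d : measure_display) (X : measurableType d).
Variable mu : {measure set X -> \bar R}.

Lemma linf_lift (g : X -> R) (c : R) : measurable_fun setT g ->
  (forall t, `|g t| <= c) -> exists x : Linfty mu, x = g %[ae mu].
Proof.
move=> mg gc.
have gL : g \in Lfun mu +oo%E.
  apply/andP; split; rewrite inE//=.
  apply: (@le_lt_trans _ _ (Num.max c 0)%:E); last by rewrite ltry.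
  apply: Lnormy_le; first by rewrite le_max lexx orbT.
  by apply: aeW => t; rewrite le_max gc.
exists (linf_class (Lfun_Sub (leey (1 : \bar R)) gL)).
exact: ae_eq_linf_class.
Qed.

Lemma ae_sumE I (r : seq I) (F : I -> Linfty mu) :
  \forall t \ae mu, (\sum_(i <- r) F i) t = \sum_(i <- r) F i t.
Proof.
elim: r => [|i r IH].
  by apply: filterS (ae_zeroE mu) => t E; rewrite !big_nil.
apply: filterS (filterI IH (ae_addE (F i) (\sum_(j <- r) F j))) => t [E1 E2].
by rewrite !big_cons E2 E1.
Qed.

Lemma ae_ex (E : set X) (P : X -> Prop) : measurable E -> (0 < mu E)%E ->
  (\forall t \ae mu, E t -> P t) -> exists2 t, E t & P t.
Proof.
move=> mE E0 [N [mN N0 EN]]; apply: contrapT => H.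
suff : (mu E <= mu N)%E by rewrite N0 leNgt E0.
apply: le_measure; rewrite ?inE// => t Et; apply: EN => /= /(_ Et) Pt.
by apply: H; exists t.
Qed.

Definition is_atom (E : set X) := [/\ measurable E, (0 < mu E)%E &
  forall B, measurable B -> B `<=` E -> mu B = 0%E \/ mu (E `\` B) = 0%E].

Lemma measurable_linf (x : Linfty mu) : measurable_fun setT (x : X -> R).
Proof. exact: (@measurable_funPT _ _ _ _ (linf_fun x)). Qed.

(** The constant is the essential infimum of [x] on [E], obtained as the supremum of the a.e. lower
    bounds [S]. Margins [n.+1%:R^-1] reduce the equality to countably many a.e. inequalities. *)
Lemma atom_ae_cst (E : set X) (x : Linfty mu) : is_atom E ->
  exists c, \forall t \ae mu, E t -> x t = c.
Proof.
move=> [mE E0 Eatom].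
pose S := [set q | \forall t \ae mu, E t -> q <= x t].
have Sn : S (- `|x|).
  apply: filterS (ae_le_linf_norm x) => t xt _.
  by rewrite lerNl (le_trans (ler_norm _))// normrN.
have SN : ubound S `|x|.
  move=> q /(filterI (ae_le_linf_norm x)) H.
  have [t Et [xt /(_ Et) qx]] : exists2 t, E t & `|x t| <= linf_norm x /\
      (E t -> q <= x t).
    by apply: ae_ex => //; apply: filterS H.
  by rewrite (le_trans qx)// (le_trans (ler_norm _)).
have Ssup : has_sup S by split; [exists (- `|x|)|exists `|x|].
exists (sup S).
have lo n : \forall t \ae mu, E t -> sup S - n.+1%:R^-1 <= x t.
  have [q Sq qS] := sup_adherent (ltac:(by rewrite invr_gt0) :
    0 < (n.+1%:R^-1 : R)) Ssup.
  by apply: filterS Sq => t /[apply]; exact/le_trans/ltW.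
have hi n : \forall t \ae mu, E t -> x t <= sup S + n.+1%:R^-1.
  set c := sup S + _.
  have ScN : ~ S c.
    move=> Sc; have := ub_le_sup (ltac:(by exists `|x|) : has_ubound S) Sc.
    by rewrite /c gerDl leNgt invr_gt0 ltr0n.
  (* [B] cannot be null, since [c] would then be an a.e. lower bound above [sup S]. So [E] being an
     atom makes the rest of [E] null. *)
  pose B := E `&` [set t | x t < c].
  have mB : measurable B.
    rewrite /B -[[set t | _]]/(x @^-1` [set r | r < c]) -set_itvNyo.
    by apply: measurableI => //; rewrite -[_ @^-1` _]setTI;
      exact: measurable_linf.
  have [B0|EB0] := Eatom B mB (@subIsetl _ _ _).
    exfalso; apply: ScN; exists B; split => // t /= /not_implyP[Et /negP].
    by rewrite -ltNge.
  exists (E `\` B); split => //; first exact: measurableD.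
  move=> t /= /not_implyP[Et /negP]; rewrite -ltNge => cx; split => // -[_] /=.
  by rewrite ltNge ltW.
apply: filterS (filterI (ae_foralln lo) (ae_foralln hi)) => t [lot hit] Et.
apply/eqP; rewrite eq_le; apply/andP; split.
  rewrite leNgt; apply/negP => /ltr_add_invr[n].
  by rewrite ltNge hit.
rewrite leNgt; apply/negP => /ltr_add_invr[n].
by rewrite -ltrBrDr ltNge lot.
Qed.

(** The a.e. value [av] on [E] is unique because [E] has positive measure; hence it is linear, and
    bounded by the norm, so weak convergence applies to it. *)
Lemma atom_weakly_cvg (y : nat -> Linfty mu) (l : Linfty mu) (E : set X) :
  weakly_cvg y l -> is_atom E -> forall e, 0 < e ->
  \forall n \near \oo, \forall t \ae mu, E t -> `|y n t - l t| <= e.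
Proof.
move=> yl aE e e0; have [mE E0 _] := aE.
have /choice[av avE] := fun x => atom_ae_cst E x aE.
have av_uniq (x : Linfty mu) c : (\forall t \ae mu, E t -> x t = c) -> av x = c.
  move=> /(filterI (avE x)) H.
  have [t Et [/(_ Et) <- /(_ Et) <-//]] : exists2 t, E t &
      (E t -> x t = av x) /\ (E t -> x t = c).
    by apply: ae_ex => //; apply: filterS H.
have av_lin : linear_for *%R av.
  move=> a x z; apply: av_uniq.
  apply: filterS (filterI (ae_addE (a *: x) z) (filterI (ae_scaleE a x)
    (filterI (avE x) (avE z)))) => t [-> [-> [xt zt]]] Et.
  by rewrite xt ?zt.
have av_le (x : Linfty mu) : `|av x| <= `|x|.
  have [t Et [/(_ Et) <-//]] : exists2 t, E t &
      (E t -> x t = av x) /\ `|x t| <= `|x|.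
    apply: ae_ex => //.
    by apply: filterS (filterI (avE x) (ae_le_linf_norm x)).
pose phi : {linear Linfty mu -> R^o} :=
  HB.pack av (GRing.isLinear.Build R (Linfty mu) R^o *:%R av av_lin).
have /yl /cvgrPdist_le/(_ e e0) : continuous phi.
  apply: bounded_linear_continuous.
  apply/linear_boundedP; exists 1; split => // r r1 x /=.
  by rewrite (le_trans (av_le x))// ler_peMl// ltW.
apply: filterS => n /= yn.
apply: filterS (filterI (avE (y n)) (avE l)) => t [yt lt] Et.
by rewrite yt ?lt// distrC.
Qed.

(** Remove a piece of the current set at each stage: every later piece lies in what remains, hence
    misses the earlier ones. *)
Lemma disjoint_seq_of_split (P : set (set X)) E0 : P E0 ->
  (forall E, P E -> exists A,
    [/\ measurable A, A `<=` E, (0 < mu A)%E & P (E `\` A)]) ->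
  exists A : nat -> set X, [/\ forall n, measurable (A n),
    trivIset setT A & forall n, (0 < mu (A n))%E].
Proof.
move=> PE0 split.
have /choice[f fP] : forall E, exists A, P E ->
    [/\ measurable A, A `<=` E, (0 < mu A)%E & P (E `\` A)].
  move=> E; have [/split[A HA]|nP] := pselect (P E); first by exists A.
  by exists set0.
pose E n := iter n (fun E => E `\` f E) E0.
have PE n : P (E n) by elim: n => //= n /fP[].
have E_le m n : (m <= n)%N -> E n `<=` E m.
  move=> /subnK <-; elim: (n - m)%N => //= k IH; apply: subset_trans IH.
  exact: subDsetl.
exists (f \o E); split=> [n|m n _ _|n]; try by have [] := fP _ (PE n).
wlog mn : m n / (m <= n)%N.
  by move=> H; have [/H//|/ltnW/H] := leqP m n; rewrite setIC => H' /H'.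
rewrite leq_eqVlt in mn; case/predU1P: mn => [//|mn] [t /= [tm tn]].
have [_ /(_ t tn)/(E_le _ _ mn) /= [_]] := fP _ (PE n).
by [].
Qed.

Lemma weakly_cvg_norm (y : nat -> Linfty mu) (l : Linfty mu) :
  ~ (exists A : nat -> set X, [/\ forall n, measurable (A n),
      trivIset setT A & forall n, (0 < mu (A n))%E]) ->
  weakly_cvg y l -> `|y n - l| @[n --> \oo] --> (0 : R).
Proof.
move=> noA yl.
pose good E := forall e, 0 < e ->
  \forall n \near \oo, \forall t \ae mu, E t -> `|y n t - l t| <= e.
have goodT : good setT.
  apply: contrapT => badT; apply: noA.
  apply: (@disjoint_seq_of_split [set E | measurable E /\ ~ good E] setT).
    by split.
  move=> E [mE badE].
  have : ~ is_atom E by move=> /(atom_weakly_cvg y l E yl).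
  have E0 : (0 < mu E)%E.
    rewrite lt0e measure_ge0 andbT; apply/eqP => E0; apply: badE => e e0.
    apply: nearW => n; exists E; split => // t /= /not_implyP[]//.
  move=> /not_and3P[//|//|/existsNP[B]].
  move=> /not_implyP[mB /not_implyP[BE /not_orP[B0 EB0]]].
  have pB : (0 < mu B)%E by rewrite lt0e measure_ge0 andbT; exact/eqP.
  have pEB : (0 < mu (E `\` B))%E by rewrite lt0e measure_ge0 andbT; exact/eqP.
  have mEB : measurable (E `\` B) by exact: measurableD.
  (* A union of two good sets is good, so [B] and its complement in [E] are not both good; the piece
     removed is the one that leaves a bad set. *)
  have [gB|bB] := pselect (good B); last first.
    exists (E `\` B); split => //; last by rewrite setDD setIidr.
  exists B; split => //; split => // gEB; apply: badE => e e0.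
  apply: filterS (filterI (gB e e0) (gEB e e0)) => n [HB1 HB2].
  apply: filterS (filterI HB1 HB2) => t [tB tEB] Et.
  by have [/tB//|Bt] := pselect (B t); apply: tEB.
apply/cvgrPdist_le => e e0; apply: filterS (goodT e e0) => n yn.
rewrite sub0r normrN normr_id.
apply: linf_norm_le; first exact: ltW.
apply: filterS (filterI yn (filterI (ae_addE (y n) (- l)) (ae_oppE l))).
by move=> t [/(_ I) yt [-> ->]].
Qed.

End linfty_facts.

Lemma norm_cvg_cesaro (R : realType) (V : normedModType R) (y : nat -> V)
    (l : V) :
  `|y n - l| @[n --> \oo] --> (0 : R) ->
  `| N%:R^-1 *: (\sum_(i < N) y i) - l | @[N --> \oo] --> (0 : R).
Proof.
move=> /cesaro H.
(* [arithmetic_mean] at index [N] averages [N.+1] terms; the shift matches this and avoids the empty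
   average. *)
rewrite -cvg_shiftS.
apply: (squeeze_cvgr _ (@cvg_cst _ 0 _ _ _) H).
apply: nearW => N; rewrite normr_ge0 /=.
have N0 : N.+1%:R != 0 :> R by [].
have -> : N.+1%:R^-1 *: (\sum_(i < N.+1) y i) - l =
    N.+1%:R^-1 *: (\sum_(i < N.+1) (y i - l)).
  rewrite sumrB sumr_const card_ord scalerBr; congr (_ - _).
  by rewrite -[l *+ _]scaler_nat scalerA mulVf// scale1r.
rewrite normrZ ger0_norm// /arithmetic_mean /series /= big_mkord.
rewrite ler_pM2l ?invr_gt0//.
exact: ler_norm_sum.
Qed.

(** * Schreier sets and the Schreier sequence *)

Section schreier_sequence.

(** Finite sets are duplicate-free lists, so that [size] is the cardinality and [pickle] provides an
    index. The empty list qualifies. *)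
Definition schreier (F : seq nat) : bool :=
  uniq F && all (fun n => size F <= n)%N F.

Lemma homo_ltn_inj (k : nat -> nat) : {homo k : i j / (i < j)%N} -> injective k.
Proof.
by move=> kS i j kij; case: (ltngtP i j) => // /kS; rewrite kij ltnn.
Qed.

Lemma homo_ltn_le (k : nat -> nat) : {homo k : i j / (i < j)%N} ->
  {homo k : i j / (i <= j)%N}.
Proof.
by move=> kS i j; rewrite leq_eqVlt => /predU1P[->//|/kS/ltnW].
Qed.

Lemma homo_ltn_ge (k : nat -> nat) i : {homo k : i j / (i < j)%N} ->
  (i <= k i)%N.
Proof.
by move=> kS; elim: i => // i /leq_ltn_trans; apply; exact: kS.
Qed.

Lemma schreier_blocks (R : realFieldType) (k : nat -> nat) :
  {homo k : i j / (i < j)%N} ->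
  exists2 s : nat -> nat, forall j, (s j < s j.+1)%N &
  forall F m, schreier F ->
    \sum_(j < m) ((s j.+1 - s j)%:R^-1 *
      \sum_(s j <= i < s j.+1) (k i \in F)%:R) <= 3 :> R.
Proof.
(* Block [j] has length [2 ^ j * (k (s j)).+1], so a set with at most [k (s j)] elements fills at
   most the fraction [2^-1 ^+ j] of it. *)
move=> kS; pose s j := iteri j (fun i x => x + 2 ^ i * (k x).+1)%N 0%N.
have sS j : s j.+1 = (s j + 2 ^ j * (k (s j)).+1)%N by [].
have s_lt j : (s j < s j.+1)%N.
  by rewrite sS -[ltnLHS]addn0 ltn_add2l muln_gt0 expn_gt0.
have s_le i j : (i <= j)%N -> (s i <= s j)%N.
  by apply: homo_ltn_le; apply: homo_ltn => //; exact: ltn_trans.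
exists s => // F m /andP[_ /allP FS].
set T := fun j : nat => (s j.+1 - s j)%:R^-1 *
  \sum_(s j <= i < s j.+1) (k i \in F)%:R : R.
pose c j := count (fun i => k i \in F) (index_iota (s j) (s j.+1)).
have TE j : T j = (s j.+1 - s j)%:R^-1 * (c j)%:R.
  congr (_ * _); rewrite -natr_sum; congr (_%:R).
  by rewrite /c -sum1_count [RHS]big_mkcond; apply: eq_bigr => i _; case: ifP.
have c_size j : (c j <= size F)%N.
  rewrite /c -size_filter -(size_map k); apply: uniq_leq_size.
    rewrite map_inj_uniq ?filter_uniq ?iota_uniq//; exact: homo_ltn_inj.
  by move=> _ /mapP[i + ->]; rewrite mem_filter => /andP[].
have c_len j : (c j <= s j.+1 - s j)%N.
  by rewrite (leq_trans (count_size _ _))// size_iota.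
have T_le1 j : T j <= 1.
  rewrite TE mulrC ler_pdivrMr ?mul1r ?ler_nat//.
  by rewrite ltr0n subn_gt0.
(* 3 - 2 (1/2)^m = 1 + \sum_(j < m) (1/2)^j: at most one block, the first one met
   by F, contributes more than (1/2)^j. *)
suff : \sum_(j < m) T j <= 3 - 2 * 2^-1 ^+ m.
  move/le_trans; apply.
  by rewrite gerBl mulr_ge0// exprn_ge0.
elim: m => [|m IH]; first by rewrite big_ord0 expr0 mulr1; lra.
have q0 : 0 <= 2^-1 ^+ m :> R by rewrite exprn_ge0.
have q1 : 2^-1 ^+ m <= 1 :> R by rewrite exprn_ile1// invf_le1// ler1n.
have -> : 3 - 2 * 2^-1 ^+ m.+1 = 3 - 2^-1 ^+ m :> R by rewrite exprS; field.
rewrite big_ord_recr/=.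
(* Either [F] is small compared with block [m], or all its elements exceed [k (s m)]; then the
   earlier blocks contribute 0 and [T m <= 1] suffices. *)
have [Fm|mF] := leqP (size F) (k (s m)).
  suff : T m <= 2^-1 ^+ m by lra.
  rewrite TE sS addKn natrM invfM natrX exprVn -mulrA.
  rewrite ger_pMr ?invr_gt0 ?exprn_gt0//.
  rewrite mulrC ler_pdivrMr// mul1r ler_nat.
  by rewrite (leq_trans (c_size m))// ltnW// ltnS.
rewrite big1 ?add0r; first by have := T_le1 m; lra.
move=> j _; rewrite TE; have -> : c j = 0%N; last by rewrite mulr0.
apply/eqP; rewrite -leqn0 leqNgt -has_count; apply/hasPn => i.
rewrite mem_index_iota => /andP[_ ij]; apply/negP => /FS.
rewrite leqNgt => /negP; apply; apply: leq_ltn_trans mF.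
apply: homo_ltn_le => //.
by rewrite (leq_trans (ltnW ij))// s_le.
Qed.

Context (R : realType) (d : measure_display) (X : measurableType d).
Variable mu : {measure set X -> \bar R}.

Lemma schreier_weakly_cvg (y : nat -> Linfty mu) :
  (\forall t \ae mu, exists2 F, schreier F & forall n, y n t = (n \in F)%:R) ->
  weakly_cvg y 0.
Proof.
move=> yF phi cphi; rewrite linear0; apply/cvgrPdist_le => e e0.
apply: contrapT => H.
have /choice[g gP] : forall N, exists n, (N <= n)%N /\ e < `|phi (y n)|.
  move=> N; apply: contrapT => /forallNP HN; apply: H; exists N => // n /= Nn.
  have /not_andP[//|/negP] := HN n.
  by rewrite -leNgt sub0r normrN.
(* Restarting the search at [j.+1] makes the chosen indices strictly increasing. *)
pose k i := iter i (fun j => g j.+1) (g 0%N).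
have kS : {homo k : i j / (i < j)%N}.
  by apply: homo_ltn => [? ? ?|i]; [exact: ltn_trans|exact: (gP _).1].
have ke i : e <= `|phi (y (k i))|.
  by case: i => [|i]; apply/ltW; exact: (gP _).2.
have [C C0 phiC] : exists2 C, 0 < C & forall x, `|phi x| <= C * `|x|.
  apply: pinfty_ex_gt0; apply/linear_boundedP.
  exact/linear_bounded_continuous.
have [s s_lt sF] := schreier_blocks R k kS.
(* The signs turn [phi (u j)] into an average of the [phi (y (k i))] in absolute value, and
   disappear from the pointwise bound by the triangle inequality. *)
pose u j : Linfty mu := (s j.+1 - s j)%:R^-1 *:
  \sum_(s j <= i < s j.+1) Num.sg (phi (y (k i)) : R) *: y (k i).
have phiu j : e <= phi (u j).
  rewrite linearZ linear_sum /=.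
  have -> : e = (s j.+1 - s j)%:R^-1 * \sum_(s j <= i < s j.+1) e.
    rewrite sumr_const_nat -[e *+ _]mulr_natl mulKf// pnatr_eq0 -lt0n subn_gt0.
    exact: s_lt.
  apply: ler_wpM2l; first by rewrite invr_ge0.
  by apply: ler_sum => i _; rewrite linearZ /= -[_ *: _]normrEsg.
have ae_u j : \forall t \ae mu, u j t = (s j.+1 - s j)%:R^-1 *
    \sum_(s j <= i < s j.+1) Num.sg (phi (y (k i)) : R) * y (k i) t.
  have Z : \forall t \ae mu, forall i, (Num.sg (phi (y (k i)) : R) *: y (k i)) t
      = Num.sg (phi (y (k i)) : R) * y (k i) t.
    by apply/ae_foralln => i; exact: ae_scaleE.
  apply: filterS (filterI (ae_scaleE (s j.+1 - s j)%:R^-1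
    (\sum_(s j <= i < s j.+1) Num.sg (phi (y (k i)) : R) *: y (k i)))
    (filterI (ae_sumE _ _ _ _ _ (index_iota (s j) (s j.+1))
      (fun i => Num.sg (phi (y (k i)) : R) *: y (k i))) Z)).
  move=> t [-> [-> Zt]]; congr (_ * _).
  by apply: eq_bigr => i _; rewrite Zt.
have u_le m : `|\sum_(j < m) u j| <= 3.
  apply: linf_norm_le => //.
  apply: filterS (filterI yF (filterI (ae_foralln ae_u)
    (ae_sumE _ _ _ _ _ (index_enum 'I_m) (fun j => u j)))).
  move=> t [[F SF yt] [ut ->]].
  apply: le_trans (sF F m SF); apply: le_trans (ler_norm_sum _ _ _) _.
  apply: ler_sum => j _; rewrite ut normrM ger0_norm ?invr_ge0//.
  apply: ler_wpM2l; first by rewrite invr_ge0.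
  apply: le_trans (ler_norm_sum _ _ _) _; apply: ler_sum => i _.
  rewrite normrM yt [`|_%:R|]ger0_norm// ler_piMl//.
  by rewrite normr_sg lern1 leq_b1.
(* For such [m], the bounds [e * m%:R] from below and [C * 3] from above on [phi] of the sum are
   incompatible. *)
have [m] : exists m : nat, C * 3 < e * m%:R.
  exists (Num.bound (C * 3 / e)); rewrite [ltRHS]mulrC -ltr_pdivrMr//.
  by apply: archi_boundP; rewrite divr_ge0 ?mulr_ge0// ltW.
apply/negP; rewrite -leNgt.
have : `|phi (\sum_(j < m) u j)| <= C * 3.
  by rewrite (le_trans (phiC _))// ler_wpM2l// ltW.
apply/le_trans/(le_trans _ (ler_norm _)); rewrite linear_sum /=.
rewrite mulr_natr -[m in e *+ m]card_ord -sumr_const.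
by apply: ler_sum => j _; exact: phiu.
Qed.

Lemma schreier_averages (y : nat -> Linfty mu) (k : nat -> nat) M :
  (forall F, schreier F -> exists A, [/\ measurable A, (0 < mu A)%E &
    \forall t \ae mu, A t -> forall n, y n t = (n \in F)%:R]) ->
  {homo k : i j / (i < j)%N} -> (0 < M)%N ->
  2^-1 <= `|(M + M)%:R^-1 *: \sum_(i < M + M) y (k i)|.
Proof.
(* The last [M] of the indices form a Schreier set because [M <= i <= k i] for each of them; their
   [M] terms all equal 1 on [A]. *)
move=> yF kS M0; pose F := map k (iota M M).
have SF : schreier F.
  rewrite /schreier map_inj_uniq ?iota_uniq; last exact: homo_ltn_inj.
  apply/allP => _ /mapP[i + ->]; rewrite mem_iota size_map size_iota.
  by move=> /andP[Mi _]; rewrite (leq_trans Mi)// homo_ltn_ge.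
have [A [mA A0 yA]] := yF F SF.
set x := _ *: _.
have [t At [yt [xt [sumt xle]]]] : exists2 t, A t &
    (forall n, y n t = (n \in F)%:R) /\
    (x t = (M + M)%:R^-1 * (\sum_(i < M + M) y (k i)) t /\
    ((\sum_(i < M + M) y (k i)) t = \sum_(i < M + M) y (k i) t /\
    `|x t| <= `|x|)).
  apply: (ae_ex _ _ _ mu) => //.
  apply: filterS (filterI yA (filterI (ae_scaleE _ _) (filterI
    (ae_sumE _ _ _ _ _ (index_enum 'I_(M + M)) (fun i => y (k i)))
    (ae_le_linf_norm x)))) => t [E1 [E2 [E3 E4]]] At.
  split; first exact: (E1 At).
  by split; [exact: E2|split; [exact: E3|exact: E4]].
rewrite (le_trans _ xle)// (le_trans _ (ler_norm _))// xt sumt.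
have MR : 0 < M%:R :> R by rewrite ltr0n.
suff : M%:R <= \sum_(i < M + M) y (k i) t.
  rewrite mulrC ler_pdivlMr ?ltr0n ?addn_gt0 ?M0// natrD.
  by have -> : 2^-1 * (M%:R + M%:R) = M%:R :> R by field.
rewrite -(big_mkord xpredT (fun i => y (k i) t)).
rewrite (@big_cat_nat _ _ _ M) ?leq_addr//=.
have -> : \sum_(M <= i < M + M) y (k i) t = M%:R.
  under eq_big_nat => i Mi.
    rewrite yt (_ : k i \in F); last by apply: map_f; rewrite mem_iota.
    over.
  by rewrite sumr_const_nat addKn.
by rewrite lerDr sumr_ge0// => i _; rewrite yt.
Qed.

(** Take for [y n] the indicator of the union of the [A (pickle F)] over Schreier [F] containing
    [n]. Disjointness and injectivity of [pickle] let each point determine its [F]. *)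
Lemma schreier_exists (A : nat -> set X) : (forall n, measurable (A n)) ->
  trivIset setT A -> exists y : nat -> Linfty mu,
  (\forall t \ae mu, exists2 F, schreier F & forall n, y n t = (n \in F)%:R) /\
  forall F, schreier F ->
    \forall t \ae mu, A (pickle F) t -> forall n, y n t = (n \in F)%:R.
Proof.
move=> mA tA.
pose D n := [set m | exists2 F, m = pickle F & schreier F && (n \in F)].
pose B n := \bigcup_(m in D n) A m.
have mB n : measurable (B n) by apply: bigcup_measurable => m _.
have /choice[y yB] : forall n, exists x : Linfty mu, x = \1_(B n) %[ae mu].
  move=> n; apply: (@linf_lift _ _ _ _ _ 1); first exact: measurable_indic.
  by move=> t; rewrite indicE ger0_norm// lern1 leq_b1.
have {}yB : \forall t \ae mu, forall n, y n t = \1_(B n) t.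
  by apply/ae_foralln => n; apply: filterS (yB n) => t /(_ I).
have BF F t n : schreier F -> A (pickle F) t -> \1_(B n) t = (n \in F)%:R :> R.
  move=> SF At; rewrite indicE; congr (nat_of_bool _)%:R.
  apply/idP/idP => [/set_mem[m [G mG /andP[SG nG]] Amt]|nF].
    suff : pickle G = pickle F by move/(pcan_inj pickleK) <-.
    by rewrite -mG; apply: (tA _ _ I I); exists t.
  by apply/mem_set; exists (pickle F) => //; exists F => //; rewrite SF.
exists y; split; last first.
  by move=> F SF; apply: filterS yB => t yt At n; rewrite yt; exact: BF.
apply: filterS yB => t yt.
have [[F SF At]|nF] := pselect (exists2 F, schreier F & A (pickle F) t).
  by exists F => // n; rewrite yt; exact: BF.
(* Outside all the sets [A (pickle F)] every [y n] vanishes, as for the empty Schreier set. *)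
exists [::] => // n; rewrite yt indicE memNset// => -[m [F mF /andP[SF _]] Amt].
by apply: nF; exists F; rewrite -?mF.
Qed.

End schreier_sequence.

Theorem theorem2p7 (R : realType) (d : measure_display) (X : measurableType d)
    (mu : {measure set X -> \bar R}) :
  ~ weak_banach_saks (Linfty mu : completeNormedModType R) <->
  exists A : nat -> set X,
    [/\ forall n, measurable (A n),
        trivIset setT A &
        forall n, (0 < mu (A n))%E].
Proof.
split=> [nWBS|[A [mA tA A0]] WBS].
  apply: contrapT => noA; apply: nWBS => y l yl.
  exists id => //; apply: norm_cvg_cesaro; exact: weakly_cvg_norm noA yl.
have [y [yae yF]] := schreier_exists _ _ _ mu A mA tA.
have [k kS] := WBS y 0 (schreier_weakly_cvg _ _ _ _ y yae).
move=> /cvgrPdist_lt/(_ 2^-1 ltac:(by rewrite invr_gt0))[N _ /= HN].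
(* With [M = N.+1], the number of terms [M + M] is past [N] and [M] is positive. *)
have := HN (N.+1 + N.+1)%N (leq_trans (leqnSn N) (leq_addr _ _)).
rewrite sub0r normrN normr_id subr0; apply/negP; rewrite -leNgt.
apply: (schreier_averages _ _ _ mu y k N.+1) => // F SF; exists (A (pickle F)).
by split=> //; exact: yF.
Qed.
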